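(* Let $X$ be a normed plane with norm $\|\cdot\|$ and let $x_1,x_2,\dots$ be an infinite sequence of unit vectors in $X$. Then there exist signs $\varepsilon_1,\varepsilon_2,\dots\in\{\pm 1\}$ such that for all $k\in\mathbf{N}$, \[\left\|\sum_{i=1}^{2k}\varepsilon_i x_i\right\|\leq 2.\] Moreover, if $X$ is the Euclidean plane, then the upper bound $2$ can be replaced by $\sqrt{2}$; that is, for every sequence $x_1,x_2,\dots$ of unit vectors in the Euclidean plane there exist signs $\varepsilon_1,\varepsilon_2,\dots\in\{\pm1\}$ such that $\left\|\sum_{i=1}^{2k}\varepsilon_i x_i\right\|\leq \sqrt{2}$ for all $k\in\mathbf{N}$.
   Context: A normed plane is a two-dimensional real normed vector space. The Euclidean plane is $\mathbf{R}^2$ with the standard Euclidean norm. $\mathbf{N}$ denotes the positive integers. *)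

(* Defs.v *)
From HB Require Import structures.
From mathcomp Require Import all_boot all_order all_algebra.
From mathcomp Require Import all_classical reals topology normedtype.

Set Implicit Arguments.
Unset Strict Implicit.
Unset Printing Implicit Defensive.

Import Order.TTheory GRing.Theory Num.Theory.
Import numFieldNormedType.Exports.

Local Open Scope ring_scope.

#[short(type="normedVectType")]
HB.structure Definition NormedVector (K : numFieldType) :=
  {V of NormedModule K V & Vector K V}.

(* The library norm on 'rV[R]_2 is the sup norm, hence an explicit one here. *)
Definition euclidean_norm (R : realType) (v : 'rV[R]_2) : R :=
  Num.sqrt (\sum_(j < 2) v ord0 j ^+ 2).

(* Main.v *)
Require Import Defs.
From HB Require Import structures.
From mathcomp Require Import all_boot all_order all_algebra.
From mathcomp Require Import all_classical reals topology normedtype.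
From mathcomp Require Import ring lra.

(**
Both bounds come from a greedy choice of the signs, two vectors at a time: if
[p] lies in the ball of radius 2 (resp. sqrt 2) and [x], [y] are unit vectors,
then one of the four points [p +/- x +/- y] lies in that ball again.

In a normed plane with [x], [y] independent, choose signs so that, up to
swapping [x] and [y], [p = l x + m y] with [0 <= m <= l]. If [l <= 2], then
[|p - x - y| <= |l - 1| + |m - 1| <= 2]. If [l > 2], solve for [x] and write
[p - x - y] as a combination of [p] and [y].

In the Euclidean plane [a = x + y] and [b = x - y] are orthogonal with
[|a|^2 + |b|^2 = 4]; if the four points [p +/- a], [p +/- b] were all outside the
ball, then expanding [|p|^2 = 2 - d] in the orthogonal directions [a], [b]
would give [|a|^2 |b|^2 <= d^2], although [|a|^2] and [|b|^2] both exceed [d].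
*)

Set Implicit Arguments.
Unset Strict Implicit.
Unset Printing Implicit Defensive.

Import Order.TTheory GRing.Theory Num.Theory.
Import numFieldNormedType.Exports.

Local Open Scope ring_scope.

Lemma greedy_signs (R : pzRingType) (V : lmodType R) (P U : V -> Prop) :
  P 0 ->
  (forall p x y, P p -> U x -> U y ->
     exists bc : bool * bool, P (p + (-1) ^+ bc.1 *: x + (-1) ^+ bc.2 *: y)) ->
  forall x : nat -> V, (forall i, U (x i)) ->
  exists2 eps : nat -> R,
    forall i, eps i = 1 \/ eps i = -1 &
    forall k, P (\sum_(i < 2 * k) eps i *: x i).
Proof.
move=> P0 step x Ux.
(* The hypotheses sit under the existential so that choice gives a total [f]; where they fail, the
   signs are arbitrary. *)
have /choice[f fP] (q : V * V * V) : exists bc : bool * bool,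
    P q.1.1 -> U q.1.2 -> U q.2 ->
    P (q.1.1 + (-1) ^+ bc.1 *: q.1.2 + (-1) ^+ bc.2 *: q.2).
  case: (pselect (P q.1.1 /\ U q.1.2 /\ U q.2)) => [[Pp [Uy Uz]]|nH].
    by have [bc ?] := step _ _ _ Pp Uy Uz; exists bc.
  by exists (false, false) => *; case: nH.
pose bits k p := f (p, x (2 * k)%N, x (2 * k).+1).
pose S := fix S k := if k is j.+1 then
  S j + (-1) ^+ (bits j (S j)).1 *: x (2 * j)%N
      + (-1) ^+ (bits j (S j)).2 *: x (2 * j).+1 else 0.
pose b i := let bc := bits i./2 (S i./2) in if odd i then bc.2 else bc.1.
exists (fun i => (-1) ^+ b i) => [i|k].
  by case: (b i); [right | left].
have -> : \sum_(i < 2 * k) (-1) ^+ b i *: x i = S k.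
  elim: k => [|k IH]; first by rewrite muln0 big_ord0.
  rewrite mulnS !big_ord_recr /= IH /b.
  by rewrite mul2n /= odd_double /= uphalf_double doubleK -!mul2n.
elim: k => [//|k IH].
exact: (fP (S k, x (2 * k)%N, x (2 * k).+1) IH (Ux _) (Ux _)).
Qed.

Section NormedStep.
Variables (R : realFieldType) (V : normedModType R).
Implicit Types (p x y : V) (l m : R).

Lemma cone_step_le l m x y : 0 <= m -> m <= l -> `|x| = 1 -> `|y| = 1 ->
  `|l *: x + m *: y| <= 2 -> `|l *: x + m *: y - x - y| <= 2.
Proof.
move=> m0 ml x1 y1; set p := _ + _ => p2.
have [l2|l2] := leP l 2.
  have -> : p - x - y = (l - 1) *: x + (m - 1) *: y.
    by rewrite !scalerBl !scale1r addrACA addrA.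
  rewrite (le_trans (ler_normD _ _))// !normrZ x1 y1 !mulr1.
  have : `|l - 1| <= 1 by rewrite ler_norml; lra.
  have : `|m - 1| <= 1 by rewrite ler_norml; lra.
  lra.
have l0 : 0 < l by lra.
have ln0 : l != 0 by rewrite gt_eqF.
(* Triangle inequality for [l *: x = p - m *: y]. *)
have lm : l <= 2 + m.
  have: `|l *: x| <= `|p| + `|m *: y|.
    by rewrite -[l *: x](addrK (m *: y)) ler_normB.
  by rewrite !normrZ x1 y1 !mulr1 (gtr0_norm l0) (ger0_norm m0); lra.
have -> : p - x - y = (1 - l^-1) *: p + (m / l - 1) *: y.
  have -> : x = l^-1 *: p - (m / l) *: y.
    rewrite scalerDr !scalerA mulVf// scale1r [l^-1 * m]mulrC addrK //.
  by rewrite opprD opprK !scalerBl !scale1r !addrA.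
have li : l^-1 <= 1 by rewrite invf_le1//; lra.
have mli : m / l <= 1 by rewrite ler_pdivrMr// mul1r.
(* The bound is [2 * (1 - l^-1) + (1 - m / l) = 3 - (2 + m) / l], at most 2 by [lm]. *)
rewrite (le_trans (ler_normD _ _))// !normrZ y1 mulr1.
rewrite ger0_norm ?subr_ge0// distrC ger0_norm ?subr_ge0//.
have : (1 - l^-1) * `|p| <= (1 - l^-1) * 2.
  by rewrite ler_wpM2l// subr_ge0.
have : 1 <= (2 + m) / l by rewrite ler_pdivlMr// mul1r.
rewrite mulrDl; lra.
Qed.

Lemma cone_step l m x y : 0 <= l -> 0 <= m -> `|x| = 1 -> `|y| = 1 ->
  `|l *: x + m *: y| <= 2 -> `|l *: x + m *: y - x - y| <= 2.
Proof.
move=> l0 m0 x1 y1; case/orP: (le_total m l) => le; first exact: cone_step_le.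
by rewrite (addrC (l *: x)) addrAC; exact: cone_step_le.
Qed.

Lemma span_step l m x y : `|x| = 1 -> `|y| = 1 ->
  `|l *: x + m *: y| <= 2 ->
  exists bc : bool * bool,
    `|l *: x + m *: y + (-1) ^+ bc.1 *: x + (-1) ^+ bc.2 *: y| <= 2.
Proof.
move=> x1 y1 p2; exists (~~ (l < 0)%R, ~~ (m < 0)%R) => /=.
have sE (a : R) (v : V) : a *: v = `|a| *: ((-1) ^+ (a < 0)%R *: v).
  by rewrite {1}[a]realEsign ?num_real// scalerA mulrC.
rewrite !signrN !scaleNr (sE l) (sE m).
by apply: cone_step; rewrite ?normrZ ?normr_sign ?mul1r// -!sE.
Qed.

End NormedStep.

Lemma plane_step (R : realType) (X : normedVectType R) (p x y : X) :
  \dim (@fullv R X) = 2%N -> `|p| <= 2 -> `|x| = 1 -> `|y| = 1 ->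
  exists bc : bool * bool,
    `|p + (-1) ^+ bc.1 *: x + (-1) ^+ bc.2 *: y| <= 2.
Proof.
move=> dim2 p2 x1 y1.
have [/vlineP[k xk]|xNy] := boolP (x \in <[y]>%VS).
  have k1 : `|k| = 1 by rewrite -x1 xk normrZ y1 mulr1.
  (* Here [k] is 1 or -1, so the two new terms can cancel, which leads back to [p]. *)
  exists (~~ (k < 0)%R, false) => /=.
  rewrite signrN expr0 scale1r scaleNr xk scalerA -{2}[k]mul1r.
  by rewrite [X in _ * (1 * X)]realEsign ?num_real// k1 mulr1 mul1r -expr2
    sqrr_sign scale1r addrNK.
have y0 : y != 0 by rewrite -normr_gt0 y1.
have spanT : (<[x]> + <[y]>)%VS = fullv.
  apply/eqP; rewrite eqEdim subvf dim2 /=.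
  have : free [:: x; y] by rewrite free_cons span_seq1 xNy seq1_free.
  by rewrite /free span_cons span_seq1 => /eqP->.
have : p \in (<[x]> + <[y]>)%VS by rewrite spanT memvf.
case/memv_addP => _ /vlineP[l ->] [_ /vlineP[m ->] pE].
by rewrite pE in p2 *; exact: span_step.
Qed.

Section EuclideanStep.
Variable R : realType.
Implicit Types p x y : 'rV[R]_2.

Lemma euclidean_normE p :
  euclidean_norm p = Num.sqrt (p ord0 0 ^+ 2 + p ord0 1 ^+ 2).
Proof.
rewrite /euclidean_norm !big_ord_recl big_ord0 addr0.
by congr (Num.sqrt (p _ _ ^+ 2 + p _ _ ^+ 2)); exact: val_inj.
Qed.

Lemma euclidean_norm_le p (r : R) : 0 <= r ->
  (euclidean_norm p <= Num.sqrt r) = (p ord0 0 ^+ 2 + p ord0 1 ^+ 2 <= r).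
Proof. by move=> r0; rewrite euclidean_normE ler_sqrt. Qed.

Lemma euclidean_norm_eq1 p :
  euclidean_norm p = 1 -> p ord0 0 ^+ 2 + p ord0 1 ^+ 2 = 1.
Proof.
rewrite euclidean_normE => /(congr1 (fun z => z ^+ 2)).
by rewrite sqr_sqrtr ?expr1n// addr_ge0// sqr_ge0.
Qed.

(* [m], [n] are the squared norms of the orthogonal vectors [x + y], [x - y],
   and [A], [B] their inner products with [p], where [|p|^2 = 2 - d]. *)
Lemma orthogonal_step (m n d A B : R) : m + n = 4 -> 0 <= d ->
  A ^+ 2 * n + B ^+ 2 * m = (2 - d) * m * n ->
  2 * `|A| <= m - d -> 2 * `|B| <= n - d -> m * n <= d ^+ 2.
Proof.
move=> mn d0 E Am Bn.
have A0 := normr_ge0 A; have B0 := normr_ge0 B.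
have A2 : 4 * A ^+ 2 <= (m - d) ^+ 2.
  by rewrite -[A ^+ 2]real_normK ?num_real//; nra.
have B2 : 4 * B ^+ 2 <= (n - d) ^+ 2.
  by rewrite -[B ^+ 2]real_normK ?num_real//; nra.
have En : n = 4 - m by lra.
have m0 : 0 <= m by lra.
have n0 : 0 <= n by lra.
(* Inserted into [E], these give [4 * (2 - d) * m * n <= (m - d) ^+ 2 * n + (n - d) ^+ 2 * m], whose
   right side is [4 * m * n - 4 * d * m * n + 4 * d ^+ 2] since [m + n = 4]. *)
have := ler_wpM2r n0 A2; have := ler_wpM2r m0 B2.
subst n; nra.
Qed.

Lemma euclidean_step p x y :
  euclidean_norm p <= Num.sqrt 2 ->
  euclidean_norm x = 1 -> euclidean_norm y = 1 ->
  exists bc : bool * bool,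
    euclidean_norm (p + (-1) ^+ bc.1 *: x + (-1) ^+ bc.2 *: y) <= Num.sqrt 2.
Proof.
move=> + /euclidean_norm_eq1 + /euclidean_norm_eq1.
rewrite euclidean_norm_le//.
set p1 := p _ 0; set p2 := p _ 1; set x1 := x _ 0; set x2 := x _ 1.
set y1 := y _ 0; set y2 := y _ 1 => Hp Hx Hy.
apply: contrapT => no.
have far (b c : bool) :
    2 < (p1 + (-1) ^+ b * x1 + (-1) ^+ c * y1) ^+ 2
      + (p2 + (-1) ^+ b * x2 + (-1) ^+ c * y2) ^+ 2.
  rewrite ltNge; apply/negP => le2; apply: no; exists (b, c).
  by rewrite euclidean_norm_le// !mxE.
have := far false false; have := far true true.
have := far false true; have := far true false.
rewrite !expr1 !expr0 => f10 f01 f11 f00 {far no}.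
pose c := x1 * y1 + x2 * y2.
pose A := p1 * (x1 + y1) + p2 * (x2 + y2).
pose B := p1 * (x1 - y1) + p2 * (x2 - y2).
pose d := 2 - (p1 ^+ 2 + p2 ^+ 2).
have d0 : 0 <= d by rewrite /d; lra.
(* Expanding [|p + a|^2 > 2] and [|p - a|^2 > 2] with [a = x + y] bounds [2 * A] from both sides;
   likewise for [B] with [x - y]. *)
have Am : 2 * `|A| < 2 + 2 * c - d.
  by case: (ger0P A) => _; rewrite /A /c /d; lra.
have Bn : 2 * `|B| < 2 - 2 * c - d.
  by case: (ger0P B) => _; rewrite /B /c /d; lra.
have A0 := normr_ge0 A; have B0 := normr_ge0 B.
(* Parseval for [p] in the directions [x + y], [x - y], cleared of denominators so that one of them
   may be zero. *)
have E : A ^+ 2 * (2 - 2 * c) + B ^+ 2 * (2 + 2 * c)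
    = (2 - d) * (2 + 2 * c) * (2 - 2 * c).
  have ab0 : (x1 + y1) * (x1 - y1) + (x2 + y2) * (x2 - y2) = 0 by lra.
  have aE : 2 + 2 * c = (x1 + y1) ^+ 2 + (x2 + y2) ^+ 2 by rewrite /c; lra.
  have bE : 2 - 2 * c = (x1 - y1) ^+ 2 + (x2 - y2) ^+ 2 by rewrite /c; lra.
  (* The Gram determinant of [p], [x + y], [x - y] vanishes in the plane. *)
  transitivity ((2 - d) * (2 + 2 * c) * (2 - 2 * c)
      + ((x1 + y1) * (x1 - y1) + (x2 + y2) * (x2 - y2))
        * (2 * A * B - (2 - d)
            * ((x1 + y1) * (x1 - y1) + (x2 + y2) * (x2 - y2)))).
    by rewrite aE bE /A /B /d; ring.
  by rewrite ab0 mul0r addr0.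
(* By [Am] and [Bn] both squared norms exceed [d >= 0], so their product exceeds [d ^+ 2]. *)
have := @orthogonal_step (2 + 2 * c) (2 - 2 * c) d A B.
move=> /(_ ltac:(lra) d0 E (ltW Am) (ltW Bn)); nra.
Qed.

End EuclideanStep.

(* Sequences are indexed from 0, so that x i stands for the (i+1)-st vector. *)
Theorem theorem4 (R : realType) :
  (forall (X : normedVectType R), \dim (@fullv R X) = 2%N ->
   forall x : nat -> X, (forall i, `|x i| = 1) ->
   exists2 eps : nat -> R,
     forall i, eps i = 1 \/ eps i = -1 &
     forall k : nat, (0 < k)%N -> `|\sum_(i < 2 * k) eps i *: x i| <= 2)
  /\
  (forall x : nat -> 'rV[R]_2, (forall i, euclidean_norm (x i) = 1) ->
   exists2 eps : nat -> R,
     forall i, eps i = 1 \/ eps i = -1 &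
     forall k : nat, (0 < k)%N ->
       euclidean_norm (\sum_(i < 2 * k) eps i *: x i) <= Num.sqrt 2).
Proof.
split=> [X dim2 x x1|x x1].
- have [||eps s le2] := @greedy_signs _ X (fun p => `|p| <= 2) (fun v => `|v| = 1) _ _ x x1.
  + by rewrite normr0.
  + by move=> p y z p2 y1 z1; exact: plane_step.
  by exists eps => // k _; exact: le2.
- have [||eps s le2] := @greedy_signs _ _ (fun p => euclidean_norm p <= Num.sqrt 2)
    (fun v => euclidean_norm v = 1) _ _ x x1.
  + by rewrite euclidean_norm_le// !mxE expr0n addr0.
  + exact: euclidean_step.
  by exists eps => // k _; exact: le2.
Qed.
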